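(* Let $k\geq 1$ be an integer and let $p(x)=a_0+a_1x+\cdots+a_kx^k\in SI^{\geq}_k$. Then $a_\nu^2\geq 4a_{\nu-1}a_{\nu+1}$ for all $\nu\in\{1,\ldots,k-1\}$. Moreover, for all integers $0\leq m<n\leq k$, the truncated polynomial $a_mx^m+a_{m+1}x^{m+1}+\cdots+a_nx^n$, if it is not identically zero, has all its nonzero (complex) roots real and negative.
   Context: A real polynomial is real-rooted if all of its complex roots are real. A real polynomial $p(x)=\sum_i a_i x^i$ is called sign-independently real-rooted if $p$ is real-rooted and every polynomial $\sum_i \varepsilon_i a_i x^i$ with $\varepsilon_i\in\{1,-1\}$ (arbitrary sign flips of the coefficients) is real-rooted as well. $SI^{\geq}_k$ is the set of sign-independently real-rooted polynomials of degree at most $k$ all of whose coefficients are nonnegative. *)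

(* Defs.v *)
From HB Require Import structures.
From mathcomp Require Import all_boot all_order all_algebra.
From mathcomp Require Import complex.
From mathcomp Require Import reals.

Set Implicit Arguments.
Unset Strict Implicit.
Unset Printing Implicit Defensive.

Import Order.TTheory GRing.Theory Num.Theory.
Local Open Scope ring_scope.

Definition complex_root (R : realType) (p : {poly R}) (z : complex R) : Prop :=
  root (map_poly (real_complex R) p) z.

(* Taken literally, the zero polynomial (every complex number is a root) is
   not real-rooted. *)
Definition real_rooted (R : realType) (p : {poly R}) : Prop :=
  forall z : complex R, complex_root p z -> complex.Im z = 0.

Definition flip_signs (R : realType) (eps : nat -> R) (p : {poly R}) :
  {poly R} := \poly_(i < size p) (eps i * p`_i).

Definition sign_independently_real_rooted (R : realType) (p : {poly R}) :
  Prop :=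
  real_rooted p /\
  forall eps : nat -> R, (forall i : nat, eps i = 1 \/ eps i = -1) ->
    real_rooted (flip_signs eps p).

Definition SI_nonneg (R : realType) (k : nat) (p : {poly R}) : Prop :=
  [/\ sign_independently_real_rooted p,
      (size p <= k.+1)%N
    & forall i : nat, 0 <= p`_i].

Definition truncation (R : realType) (m n : nat) (p : {poly R}) : {poly R} :=
  \sum_(m <= i < n.+1) p`_i *: 'X^i.

(* Main.v *)
Require Import Defs.
From HB Require Import structures.
From mathcomp Require Import all_boot all_order all_algebra.
From mathcomp Require Import complex.
From mathcomp Require Import boolp reals.
From mathcomp Require Import ring lra zify.

Set Implicit Arguments.
Unset Strict Implicit.
Unset Printing Implicit Defensive.

Import Order.TTheory GRing.Theory Num.Theory.
Local Open Scope ring_scope.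

(* If a_nu > 0 and nu < deg p, the sign flip 2 a_nu x^nu - p(x) is real-rooted
   and has coefficients of both signs, so its roots are not all <= 0: there is
   x > 0 where a_nu x^nu equals the sum of all the other terms of p.  Comparing
   with the two neighbouring terms and applying AM-GM gives
   a_nu^2 >= 4 a_(nu-1) a_(nu+1).

   The support of p is an interval, so a nonzero truncation is x^M g(x) with
   g = b_0 + ... + b_L x^L, all b_i > 0, and each b_i with i < L dominates g at
   some y_i > 0.  Hence g(-y_i) has the sign (-1)^i (weakly for i = L - 1),
   which yields L - 1 distinct real roots; a nonreal root and its conjugate
   would exceed the degree L. *)

(** * Coefficients of real-rooted polynomials with nonpositive roots *)

(** Multiplying by X - r with r <= 0 adds nonnegative multiples of neighbouring coefficients, so
    nothing cancels and no gap opens above a positive coefficient. *)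
Lemma prod_XsubC_nonpos_coefs (R : realDomainType) (s : seq R) :
  all (fun x => x <= 0) s ->
  let q := \prod_(x <- s) ('X - x%:P) in
  (forall i, 0 <= q`_i) /\
  (forall i, 0 < q`_i -> (i < size s)%N -> 0 < q`_i.+1).
Proof.
elim: s => [_|r s IHs /= /andP[r_le0 /IHs [q_ge0 q_gt0]]] /=.
  rewrite big_nil; split=> i; last by rewrite ltn0.
  by rewrite coef1 ler0n.
rewrite big_cons; set q := \prod_(_ <- s) _ in q_ge0 q_gt0 *.
have coefE i : (('X - r%:P) * q)`_i = (if i is j.+1 then q`_j else 0) - r * q`_i.
  by rewrite mulrBl coefB coefXM coefCM; case: i.
have rq_ge0 i : 0 <= - r * q`_i by rewrite mulr_ge0 ?oppr_ge0.
split=> i; rewrite !coefE -?mulNr.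
  by rewrite addr_ge0 //; case: i.
move=> c_gt0 lt_is; rewrite ltr_wpDr // lt_neqAle q_ge0 andbT eq_sym.
(* If q_i = 0, positivity of the new coefficient i comes from q_(i-1) > 0, which by induction forces
   q_i > 0. *)
apply: contraTneq c_gt0 => qi0; rewrite qi0 mulr0 addr0 -leNgt.
case: i qi0 lt_is => // i qi0 lt_is.
by rewrite leNgt; apply/negP => /q_gt0/(_ lt_is); rewrite qi0 ltxx.
Qed.

(** Since all complex roots are real, the factorization over the complex field is the image of a
    real one, and [map_poly] is injective. *)
Lemma real_rooted_split (R : realType) (q : {poly R}) :
  real_rooted q ->
  exists2 s : seq R, q = lead_coef q *: \prod_(x <- s) ('X - x%:P)
                   & all (root q) s.
Proof.
move=> q_rr; have q_neq0 : q != 0.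
  (* Every complex number is a root of 0, in particular the nonreal ['i]. *)
  apply/eqP => q0; have := q_rr 'i%C.
  rewrite /complex_root q0 rmorph0 root0 => /(_ isT) /= /eqP.
  by rewrite oner_eq0.
have [rs def_q] := closed_field_poly_normal (map_poly (real_complex R) q).
have lc_neq0 : lead_coef (map_poly (real_complex R) q) != 0.
  by rewrite lead_coef_eq0 map_poly_eq0.
have rootE z : root (map_poly (real_complex R) q) z = (z \in rs).
  by rewrite def_q rootZ // root_prod_XsubC.
have rs_real z : z \in rs -> z = real_complex R (complex.Re z).
  rewrite -rootE => /q_rr; case: z => a b /= ->; exact: erefl.
exists [seq complex.Re z | z <- rs].
  apply: (map_poly_inj (real_complex R)); rewrite def_q lead_coef_map.
  rewrite [in RHS]linearZ /= rmorph_prod big_map; congr (_ *: _).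
  rewrite !big_seq; apply: eq_bigr => z /rs_real {1}->.
  by rewrite rmorphB /= map_polyX map_polyC.
apply/allP => _ /mapP[z z_rs ->].
by move: (z_rs); rewrite -rootE {1}(rs_real z z_rs) fmorph_root.
Qed.

Lemma real_rooted_nonpos_coefs (R : realType) (q : {poly R}) :
  real_rooted q -> (forall x, root q x -> x <= 0) ->
  (forall i, 0 <= lead_coef q * q`_i) /\
  (forall i, q`_i != 0 -> (i.+1 < size q)%N -> q`_i.+1 != 0).
Proof.
move=> q_rr roots_le0; have [s def_q /allP roots_s] := real_rooted_split q_rr.
have s_le0 : all (fun x => x <= 0) s by apply/allP => x /roots_s/roots_le0.
have [c_ge0 c_gt0] := prod_XsubC_nonpos_coefs s_le0.
split=> i.
  by rewrite {2}def_q coefZ mulrA mulr_ge0 // -expr2 sqr_ge0.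
rewrite {1 3}def_q !coefZ !mulf_eq0 !negb_or => /andP[lc_neq0 ci_neq0] lt_i.
rewrite lc_neq0 gt_eqF // c_gt0 ?lt_neqAle ?c_ge0 1?eq_sym ?ci_neq0 //.
by move: lt_i; rewrite def_q size_scale // size_prod_XsubC ltnS.
Qed.

(** * Values at positive points and dominant terms *)

Lemma horner_ge0 (R : realDomainType) (p : {poly R}) (x : R) :
  (forall i, 0 <= p`_i) -> 0 <= x -> 0 <= p.[x].
Proof.
move=> p_ge0 x_ge0; rewrite horner_coef sumr_ge0 // => i _.
by rewrite mulr_ge0 ?exprn_ge0.
Qed.

Lemma horner_gt0 (R : realDomainType) (p : {poly R}) (x : R) :
  (forall i, 0 <= p`_i) -> p != 0 -> 0 < x -> 0 < p.[x].
Proof.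
move=> p_ge0 p_neq0 x_gt0.
have p_size : (0 < size p)%N by rewrite lt0n size_poly_eq0.
rewrite horner_coef -(prednK p_size) big_ord_recr /= ltr_wpDl //.
  by apply: sumr_ge0 => i _; rewrite mulr_ge0 ?exprn_ge0 ?(ltW x_gt0).
rewrite mulr_gt0 ?exprn_gt0 // lt_neqAle p_ge0 andbT eq_sym.
by rewrite -lead_coefE lead_coef_eq0.
Qed.

Lemma root_le0 (R : realDomainType) (p : {poly R}) (x : R) :
  (forall i, 0 <= p`_i) -> p != 0 -> root p x -> x <= 0.
Proof.
move=> p_ge0 p_neq0; apply: contraTT; rewrite -ltNge => x_gt0.
by rewrite rootE gt_eqF // horner_gt0.
Qed.

Lemma SI_dominant_point (R : realType) (k : nat) (p : {poly R}) (nu : nat) :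
  SI_nonneg k p -> p`_nu != 0 -> (nu < (size p).-1)%N ->
  exists2 x, 0 < x & p.[x] = 2 * p`_nu * x ^+ nu.
Proof.
move=> [[_ flip_rr] _ p_ge0] pnu_neq0 lt_nu.
pose eps i : R := if i == nu then 1 else -1.
have epsP i : eps i = 1 \/ eps i = -1 by rewrite /eps; case: eqP; [left|right].
set P := flip_signs eps p.
have p_neq0 : p != 0 by apply: contraNneq pnu_neq0 => ->; rewrite coef0.
have PE : P = (2 * p`_nu) *: 'X^nu - p.
  apply/polyP=> i; rewrite coef_poly coefB coefZ coefXn /eps.
  case: ltnP => [_|le_i]; last first.
    by rewrite [p`_i]nth_default // gtn_eqF ?mulr0 ?subr0 //; lia.
  by case: eqP => [->|_] /=; lra.
have [[x x_gt0 Px]|no_root] := pselect (exists2 x, 0 < x & root P x).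
  exists x => //; move: Px.
  rewrite /root PE hornerD hornerN hornerZ hornerXn subr_eq0.
  by move/eqP.
(* Without a positive root, no coefficient of [P] has the sign opposite to its leading one. But
   coefficient [nu] is positive, while the leading one is [- lead_coef p], as [nu] lies below the
   degree. *)
have [x Px|/(_ nu) + _] := real_rooted_nonpos_coefs (flip_rr eps epsP).
  by rewrite leNgt; apply/negP => x_gt0; apply: no_root; exists x.
have p_size : (0 < size p)%N by rewrite lt0n size_poly_eq0.
have ltp : lead_coef p != 0 by rewrite lead_coef_eq0.
have eps_lead : eps (size p).-1 = -1 by rewrite /eps gtn_eqF.
rewrite lead_coef_poly ?eps_lead // ?mulN1r ?oppr_eq0 //.
rewrite -/P PE coefB coefZ coefXn eqxx mulr1.
have : 0 < lead_coef p * p`_nu.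
  by rewrite mulr_gt0 // lt_neqAle eq_sym p_ge0 andbT.
rewrite lead_coefE; lra.
Qed.

(** * Sign changes on the negative axis and real-rootedness *)

(** Adding g(y) to (-1)^i g(-y) doubles the terms whose index has the parity of i and kills the
    others. The bound on g(y) uses up the doubled term i, and the doubled term i+2 is left over. *)
Lemma reflected_horner (R : realDomainType) (g : {poly R}) (i : nat) (y : R) :
  (forall j, 0 <= g`_j) -> 0 <= y -> g.[y] <= 2 * g`_i * y ^+ i ->
  2 * g`_i.+2 * y ^+ i.+2 <= (-1) ^+ i * g.[- y].
Proof.
move=> g_ge0 y_ge0 dom_i.
have evenpart : (-1) ^+ i * g.[- y] + g.[y] =
    \sum_(j < size g) (1 + (-1) ^+ (i + j)) * g`_j * y ^+ j.
  rewrite !horner_coef mulr_sumr -big_split; apply: eq_bigr => j _ /=.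
  by rewrite [(- y) ^+ j]exprNn exprD; ring.
have term_ge0 j : 0 <= (1 + (-1) ^+ (i + j)) * g`_j * y ^+ j.
  rewrite !mulr_ge0 ?exprn_ge0 //.
  by rewrite -signr_odd; case: odd; rewrite ?expr1 ?expr0; lra.
have sgnii : (-1) ^+ (i + i) = 1 :> R by rewrite addnn -mul2n exprM sqrrN !expr1n.
have sgnii2 : (-1) ^+ (i + i.+2) = 1 :> R.
  by rewrite !addnS !exprS sgnii mulrA mulrNN !mulr1.
suff : 2 * g`_i * y ^+ i + 2 * g`_i.+2 * y ^+ i.+2 <= (-1) ^+ i * g.[- y] + g.[y].
  by lra.
rewrite evenpart.
have [lt_i2|le_i2] := ltnP i.+2 (size g); last first.
  rewrite [g`_i.+2]nth_default // mulr0 mul0r addr0.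
  have [lt_i|le_i] := ltnP i (size g); last first.
    by rewrite nth_default // mulr0 mul0r sumr_ge0.
  by rewrite (bigD1 (Ordinal lt_i)) //= sgnii lerDl sumr_ge0.
have lt_i : (i < size g)%N by lia.
rewrite (bigD1 (Ordinal lt_i)) //= (bigD1 (Ordinal lt_i2)) /=; last first.
  by rewrite -val_eqE /=; lia.
by rewrite sgnii sgnii2 addrA lerDl sumr_ge0.
Qed.

(* The dominance inequalities force [y_K <= g_K / g_(K+1) <= y_(K+1)], so the
   points are automatically ordered and the sign changes give distinct roots. *)
Lemma dominated_roots (R : rcfType) (g : {poly R}) (K : nat) :
  (forall i, 0 <= g`_i) -> (forall i, (i < size g)%N -> 0 < g`_i) ->
  (forall i, (i.+1 < size g)%N ->
     exists2 y, 0 < y & g.[y] <= 2 * g`_i * y ^+ i) ->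
  (K.+1 < size g)%N ->
  exists s : seq R, exists y : R,
    [/\ 0 < y, g.[y] <= 2 * g`_K * y ^+ K, uniq s, size s = K
      & forall x, x \in s -> root g x /\ - y <= x].
Proof.
move=> g_ge0 g_gt0 g_dom; elim: K => [|K IHK] ltK.
  by have [y y_gt0 dom_y] := g_dom 0%N ltK; exists [::], y; split.
have [|s [y [y_gt0 dom_y s_uniq s_size sP]]] := IHK; first by lia.
have [y' y'_gt0 dom_y'] := g_dom _ ltK.
(* The sign at [- y] is strict because [K.+2] is still an index of [g]. At [- y'] it is only weak:
   [K.+3] may exceed the degree, where the coefficient is 0. *)
have sgn_y : 0 < (-1) ^+ K * g.[- y].
  apply: lt_le_trans (reflected_horner g_ge0 (ltW y_gt0) dom_y).
  by rewrite mulr_gt0 ?exprn_gt0 // mulr_gt0 // g_gt0.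
have sgn_y' : 0 <= (-1) ^+ K.+1 * g.[- y'].
  apply: le_trans (reflected_horner g_ge0 (ltW y'_gt0) dom_y').
  by rewrite mulr_ge0 ?exprn_ge0 ?(ltW y'_gt0) // mulr_ge0.
have two_terms (i j : nat) x : (i < size g)%N -> (j < size g)%N -> i != j ->
    0 < x -> g`_i * x ^+ i + g`_j * x ^+ j <= g.[x].
  move=> lti ltj neq_ij x_gt0; rewrite horner_coef.
  rewrite (bigD1 (Ordinal lti)) //= (bigD1 (Ordinal ltj)) /=; last first.
    by rewrite -val_eqE /= eq_sym.
  rewrite addrA lerDl sumr_ge0 // => l _.
  by rewrite mulr_ge0 ?exprn_ge0 ?(ltW x_gt0).
have le_y : y <= y'.
  have := two_terms K K.+1 y (ltnW (ltnW ltK)) (ltnW ltK) _ y_gt0.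
  rewrite neq_ltn ltnSn => /(_ isT) low_y.
  have := two_terms K K.+1 y' (ltnW (ltnW ltK)) (ltnW ltK) _ y'_gt0.
  rewrite neq_ltn ltnSn => /(_ isT) low_y'.
  have le1 : g`_K.+1 * y <= g`_K.
    rewrite -(ler_pM2r (exprn_gt0 K y_gt0)) -mulrA -exprS; lra.
  have le2 : g`_K <= g`_K.+1 * y'.
    rewrite -(ler_pM2r (exprn_gt0 K y'_gt0)) -mulrA -exprS; lra.
  by rewrite -(ler_pM2l (g_gt0 _ (ltnW ltK))) (le_trans le1).
have [x /andP[le_x x_le] rootx] :
    exists2 x, - y' <= x <= - y & root ((-1) ^+ K *: g) x.
  apply: poly_ivt; first by rewrite lerN2.
  rewrite !hornerZ (ltW sgn_y) andbT -oppr_ge0 -mulNr.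
  by rewrite -[- _]mulN1r -exprS.
have {}rootx : root g x by rewrite rootZ ?signr_eq0 in rootx.
(* The strict sign at [- y] separates the new root from the earlier ones, which are all at least
   [- y]. *)
have lt_x : x < - y.
  rewrite lt_neqAle x_le andbT; apply: contraTneq sgn_y => <-.
  by rewrite (rootP rootx) mulr0 ltxx.
exists (x :: s), y'; split => //=.
- rewrite s_uniq andbT; apply/negP => /sP[_].
  by rewrite leNgt lt_x.
- by rewrite s_size.
move=> z; rewrite inE => /orP[/eqP->//|/sP[rz le_z]].
by split=> //; apply: le_trans le_z; rewrite lerN2.
Qed.

Lemma dominated_real_rooted (R : realType) (g : {poly R}) :
  (forall i, 0 <= g`_i) -> (forall i, (i < size g)%N -> 0 < g`_i) ->
  (forall i, (i.+1 < size g)%N ->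
     exists2 y, 0 < y & g.[y] <= 2 * g`_i * y ^+ i) ->
  g != 0 -> real_rooted g.
Proof.
move=> g_ge0 g_gt0 g_dom g_neq0 z rootz; apply/eqP/negPn/negP => z_nreal.
have size_gt1 : (1 < size g)%N.
  have := root_size_gt1 _ rootz.
  by rewrite size_map_poly map_poly_eq0 => ->.
have size_gE : (size g).-2.+2 = size g by case: (size g) size_gt1 => [|[]].
(* [K] is the degree minus one, the last index for which domination is assumed. *)
have [|s [y [_ _ s_uniq s_size sP]]] :=
  dominated_roots (K := (size g).-2) g_ge0 g_gt0 g_dom; first by rewrite size_gE.
have conj_root : complex_root g z^*%C.
  rewrite /complex_root -complex_root_conj -map_poly_comp.
  rewrite (eq_map_poly (g := real_complex R)) // => x /=.
  exact: conjc_real.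
have notin_s w : complex.Im w != 0 -> w \notin map (real_complex R) s.
  by apply: contraNN => /mapP[x _ ->].
have := @max_poly_roots _ (map_poly (real_complex R) g)
  [:: z, z^*%C & map (real_complex R) s].
rewrite map_poly_eq0 size_map_poly /= size_map s_size => /(_ g_neq0) max_roots.
suff : ((size g).-2.+2 < size g)%N by rewrite size_gE ltnn.
apply: max_roots.
  rewrite rootz conj_root /=; apply/allP => _ /mapP[x /sP[rx _] ->].
  by rewrite fmorph_root.
rewrite !inE !negb_or !notin_s //=; last first.
  by case: (z) z_nreal => a b /=; rewrite oppr_eq0.
rewrite map_inj_uniq ?s_uniq ?andbT; last exact: (fmorph_inj (real_complex R)).
case: (z) z_nreal => a b /= b_neq0; rewrite eq_complex /= eqxx /=.
by apply: contraNneq b_neq0 => ?; apply/eqP; lra.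
Qed.

(** * Support, coefficient inequality and truncations *)

(** Nonnegative coefficients exclude positive roots, so nonvanishing propagates upwards from
    coefficient [i] to the degree. *)
Lemma SI_support (R : realType) (k : nat) (p : {poly R}) (i j : nat) :
  SI_nonneg k p -> p`_i != 0 -> (i <= j < size p)%N -> p`_j != 0.
Proof.
move=> [[p_rr _] _ p_ge0] pi_neq0.
have p_neq0 : p != 0 by apply: contraNneq pi_neq0 => ->; rewrite coef0.
have [_ p_succ] :=
  real_rooted_nonpos_coefs p_rr (fun x => root_le0 p_ge0 p_neq0).
elim: j => [|j IHj] /andP[le_ij lt_j]; first by move: le_ij; rewrite leqn0 => /eqP <-.
move: le_ij; rewrite leq_eqVlt => /orP[/eqP<- //|lt_ij].
by apply: p_succ => //; apply: IHj; rewrite -ltnS lt_ij ltnW.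
Qed.

Lemma coef_truncation (R : realType) (m n : nat) (p : {poly R}) (i : nat) :
  (truncation m n p)`_i = if (m <= i <= n)%N then p`_i else 0.
Proof.
rewrite /truncation coef_sum; case: ifP => i_mn.
  rewrite (bigD1_seq i) ?iota_uniq ?mem_index_iota //=.
  rewrite coefZ coefXn eqxx mulr1 big1 ?addr0 // => j neq_ji.
  by rewrite coefZ coefXn eq_sym (negPf neq_ji) mulr0.
rewrite big1_seq // => j /andP[_]; rewrite mem_index_iota ltnS => j_mn.
rewrite coefZ coefXn; case: eqP => [eq_ij|]; last by rewrite mulr0.
by rewrite -eq_ij i_mn in j_mn.
Qed.

Lemma SI_newton (R : realType) (k : nat) (p : {poly R}) (i : nat) :
  SI_nonneg k p -> 4 * p`_i * p`_i.+2 <= p`_i.+1 ^+ 2.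
Proof.
move=> p_SI; have [_ _ p_ge0] := p_SI.
have [->|pi_neq0] := eqVneq p`_i 0; first by rewrite mulr0 mul0r sqr_ge0.
have [->|pi2_neq0] := eqVneq p`_i.+2 0; first by rewrite mulr0 sqr_ge0.
have lt_i2 : (i.+2 < size p)%N.
  by rewrite ltnNge; apply: contra_neqN pi2_neq0; apply: nth_default.
have pi1_neq0 : p`_i.+1 != 0.
  by apply: SI_support p_SI pi_neq0 _; rewrite leqnSn ltnW.
have [|x x_gt0 px] := SI_dominant_point p_SI pi1_neq0; first by lia.
have : p`_i + p`_i.+2 * x ^+ 2 <= p`_i.+1 * x.
  rewrite -(ler_pM2r (exprn_gt0 i x_gt0)).
  have : p`_i * x ^+ i + (p`_i.+1 * x ^+ i.+1 + p`_i.+2 * x ^+ i.+2) <= p.[x].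
    (* [q] is [p] without its terms i, i+1 and i+2; its coefficients stay nonnegative. *)
    pose q := p - \poly_(j < i.+3) (if (i <= j)%N then p`_j else 0).
    have q_ge0 j : 0 <= q`_j.
      by rewrite coefB coef_poly; do ?case: ifP => _; rewrite ?subrr ?subr0 ?p_ge0 ?lexx.
    have := horner_ge0 q_ge0 (ltW x_gt0).
    rewrite hornerD hornerN subr_ge0; apply: le_trans.
    rewrite horner_poly !big_ord_recr /= leqnn leqnSn (leqW (leqnSn i)).
    rewrite -!addrA lerDr sumr_ge0 // => j _.
    by rewrite mulr_ge0 ?exprn_ge0 ?(ltW x_gt0) //; case: ifP.
  by rewrite px !exprS; lra.
(* Writing a, b, c for the three coefficients, 4ac x^2 <= (a + c x^2)^2 <= b^2 x^2, and x^2
   cancels. *)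
move=> dom_x; rewrite -(ler_pM2r (exprn_gt0 2 x_gt0)).
have sum_ge0 : 0 <= p`_i + p`_i.+2 * x ^+ 2.
  by rewrite addr_ge0 // mulr_ge0 ?sqr_ge0.
have := lerXn2r 2 sum_ge0 (le_trans sum_ge0 dom_x) dom_x.
have := sqr_ge0 (p`_i - p`_i.+2 * x ^+ 2).
nra.
Qed.

(** Splitting off the exact power of X leaves a [g] with nonzero constant term. Since the support of
    [p] has no gaps, all coefficients of [g] up to its degree are positive, as the root count
    requires. *)
Lemma SI_truncation_factor (R : realType) (k m n : nat) (p : {poly R}) :
  SI_nonneg k p -> truncation m n p != 0 ->
  exists M : nat, exists g : {poly R},
    [/\ truncation m n p = g * 'X^M, real_rooted g,
        (forall i, 0 <= g`_i), g != 0 & g`_0 != 0].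
Proof.
move=> p_SI; have [_ _ p_ge0] := p_SI.
set t := truncation m n p => t_neq0.
have t_neq0P i : t`_i != 0 -> (m <= i <= n)%N /\ p`_i != 0.
  by rewrite coef_truncation; case: ifP; rewrite ?eqxx.
have [M [g]] := multiplicity_XsubC t 0; rewrite t_neq0 polyC0 subr0 /= => g0 def_t.
have g_neq0 : g != 0 by apply: contraNneq g0 => ->; rewrite root0.
have {}g0 : g`_0 != 0 by rewrite -horner_coef0.
have tE i : t`_(M + i) = g`_i by rewrite def_t coefMXn ltnNge leq_addr addKn.
have size_t : size t = (M + size g)%N by rewrite def_t size_mulXn.
have size_g : (0 < size g)%N by rewrite lt0n size_poly_eq0.
have [/andP[le_mM _] pM] : (m <= M <= n)%N /\ p`_M != 0.
  by apply: t_neq0P; rewrite -[M]addn0 tE.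
have [/andP[_ le_n] pd] : (m <= M + (size g).-1 <= n)%N /\ p`_(M + (size g).-1) != 0.
  by apply: t_neq0P; rewrite tE -lead_coefE lead_coef_eq0.
have lt_d : (M + (size g).-1 < size p)%N.
  by rewrite ltnNge; apply: contra_neqN pd; apply: nth_default.
have le_d : (M + (size g).-1 <= (size p).-1)%N by lia.
have g_ge0 i : 0 <= g`_i by rewrite -tE coef_truncation; case: ifP.
have gE i : (i < size g)%N -> g`_i = p`_(M + i).
  by move=> lt_i; rewrite -tE coef_truncation ifT //; lia.
have g_gt0 i : (i < size g)%N -> 0 < g`_i.
  move=> lt_i; rewrite lt_neqAle g_ge0 andbT eq_sym gE //.
  by apply: SI_support p_SI pM _; lia.
exists M, g; split=> //.
apply: dominated_real_rooted => // i lt_i.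
have lt_i' : (i < size g)%N by exact: ltnW.
have [||x x_gt0 px] := SI_dominant_point (nu := M + i) p_SI.
- by rewrite -gE // gt_eqF // g_gt0.
- by apply: leq_trans le_d; rewrite ltn_add2l -ltnS prednK.
have tx : t.[x] = g.[x] * x ^+ M by rewrite def_t hornerM hornerXn.
have domE : 2 * g`_i * x ^+ i * x ^+ M = p.[x].
  by rewrite px gE // -mulrA -exprD addnC.
(* The dropped terms are nonnegative at x > 0, so the truncation is at most [p] there; dividing by
   x^M turns dominance of term M + i in [p] into dominance of term i in [g]. *)
exists x => //; rewrite -(ler_pM2r (exprn_gt0 M x_gt0)) domE -tx.
rewrite -subr_ge0 -hornerN -hornerD.
apply: horner_ge0 (ltW x_gt0) => j.
by rewrite coefB coef_truncation; case: ifP => _; rewrite ?subrr ?subr0 ?p_ge0 ?lexx.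
Qed.

Theorem corollary1 (R : realType) (k : nat) (hk : (1 <= k)%N)
    (p : {poly R}) (hp : SI_nonneg k p) :
  (forall nu : nat, (1 <= nu <= k - 1)%N ->
     4%:R * p`_(nu - 1) * p`_(nu + 1) <= p`_nu ^+ 2) /\
  (forall m n : nat, (m < n <= k)%N ->
     truncation m n p != 0 ->
     forall z : complex R, complex_root (truncation m n p) z -> z != 0 ->
       complex.Im z = 0 /\ complex.Re z < 0).
Proof.
split=> [[//|nu] _|m n _ t_neq0 z].
  by rewrite subn1 addn1; apply: SI_newton hp.
have [M [g [-> g_rr g_ge0 g_neq0 g0_neq0]]] := SI_truncation_factor hp t_neq0.
rewrite /complex_root rmorphM rootM /= map_polyXn => /orP[rootz _|]; last first.
  by rewrite rootE hornerXn expf_eq0 => /andP[_ ->].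
have Im_z := g_rr z rootz; split=> //.
have {}rootz : root g (complex.Re z).
  rewrite -(fmorph_root (real_complex R)).
  by case: z Im_z rootz => a b /= ->.
(* The inequality is strict because g(0) is the nonzero constant term. *)
rewrite lt_neqAle (root_le0 g_ge0) // andbT.
by apply: contraTneq rootz => ->; rewrite rootE horner_coef0.
Qed.
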